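(* Let $n\ge 2$, let $A,B$ be real symmetric $n\times n$ matrices, $a,b\in\mathbb{R}^n$, $f(x)=\langle Ax,x\rangle+\langle a,x\rangle$, $g(x)=\langle Bx,x\rangle+\langle b,x\rangle$, $F(x)=(f(x),g(x))$ and $F_H(x)=(\langle Ax,x\rangle,\langle Bx,x\rangle)$ for $x\in\mathbb{R}^n$. If either $\operatorname{int}F_H(\mathbb{R}^n)\neq\emptyset$ or ND holds for $A$ and $B$, then $F(\mathbb{R}^n)$ is convex.
   Context: $\operatorname{int}$ denotes the topological interior in $\mathbb{R}^2$. ND (non-degenerate) holds for $A$ and $B$ if, for $u\in\mathbb{R}^n$, $\langle Au,u\rangle=0=\langle Bu,u\rangle$ implies $u=0$. *)

(* Defs.v *)
From HB Require Import structures.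
From mathcomp Require Import all_boot all_order all_algebra.
From mathcomp Require Import all_classical all_reals all_analysis.
Import Order.TTheory GRing.Theory Num.Theory.
Import numFieldNormedType.Exports.

Set Implicit Arguments.
Unset Strict Implicit.
Unset Printing Implicit Defensive.

Local Open Scope classical_set_scope.
Local Open Scope ring_scope.

Definition dotv (R : realType) (n : nat) (x y : 'cV[R]_n) : R :=
  \sum_(i < n) x i ord0 * y i ord0.

Definition quad (R : realType) (n : nat) (A : 'M[R]_n) (a x : 'cV[R]_n) : R :=
  dotv (A *m x) x + dotv a x.

(* The plane is [R^o * R^o]: [R^o] carries the R-module structure required by
   [convex_set], and the product carries the usual topology of R^2. *)
Definition joint_map (R : realType) (n : nat) (A B : 'M[R]_n)
    (a b x : 'cV[R]_n) : R^o * R^o :=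
  (quad A a x, quad B b x).

Definition joint_map_hom (R : realType) (n : nat) (A B : 'M[R]_n)
    (x : 'cV[R]_n) : R^o * R^o :=
  (dotv (A *m x) x, dotv (B *m x) x).

Definition nondegenerate_pair (R : realType) (n : nat) (A B : 'M[R]_n) : Prop :=
  forall u : 'cV[R]_n, dotv (A *m u) u = 0 -> dotv (B *m u) u = 0 -> u = 0.

(* Main.v *)
Require Import Defs.
From HB Require Import structures.
From mathcomp Require Import all_boot all_order all_algebra.
From mathcomp Require Import all_classical all_reals all_analysis.
From mathcomp Require Import ring lra.
Import Order.TTheory GRing.Theory Num.Theory.
Import numFieldNormedType.Exports.

Local Open Scope classical_set_scope.
Local Open Scope ring_scope.

(* A point of the segment between two values of [F] that is missed by [F] can,
   after a change of basis of the plane, be taken to be the origin, so that [g]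
   vanishes at both ends [m - d], [m + d] of a chord while [f] changes sign, and
   [f], [g] have no common zero. If [g] vanished on the whole line, [f] would have
   a zero on it, hence [<Bd, d> <> 0]. For [v] with [<Bd, v> = 0], the curve
   [g = 0] in the plane [m + s v + t d] is [t^2 = 1 - l s - beta s^2]. If its
   right-hand side vanished somewhere, the two end points could be joined inside
   the curve and [f] would vanish on it. So the curve has two branches, [f > 0]
   on one and [f < 0] on the other; comparing growth as [s] tends to both
   infinities forces [beta <= 0], [<Ad, v> = 0] and [<Av, v> = beta <Ad, d>].
   Hence [v + sqrt (- beta) d] is isotropic for both forms, and [A] and [B] are
   proportional as quadratic forms, so that neither hypothesis can hold. *)

(** * Zeros and continuity of real functions *)

(** The zero is sought as [c * s] so that [s] may have either sign. *)
Lemma continuous_zero_between (R : realType) (phi : R -> R) (s : R) :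
  continuous phi -> phi 0 * phi s <= 0 ->
  exists2 c, 0 <= c <= 1 & phi (c * s) = 0.
Proof.
move=> cphi le0.
have cpsi : continuous (fun c : R => phi (c * s)).
  by move=> c; apply: (@continuous_comp R R R (fun c => c * s));
    [exact: mulrr_continuous | exact: cphi].
have [||c c01 hc] := @IVT R (fun c => phi (c * s)) 0 1 0 ler01.
- by apply: continuous_subspaceT => c; exact: cpsi.
- rewrite mul0r mul1r ge_min le_max.
  by apply/andP; split; apply/orP; case: (lerP (phi 0) 0) => h0;
     case: (lerP (phi s) 0) => h1; (try by [left | right]); nra.
- by exists c => //; move: c01; rewrite in_itv.
Qed.

(** This is [f] along one branch of the conic; negating [c2] and [c4] gives the other. [Num.sqrt] is
    [0] on negative reals, so continuity holds at every [s]. *)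
Lemma continuous_root_conic {R : realType} (l beta c0 c1 c2 c3 c4 c5 : R) :
  continuous (fun s : R => let r := Num.sqrt (1 - l * s - beta * s ^+ 2) in
    c0 + c1 * s + c2 * r + c3 * s ^+ 2 + c4 * s * r + c5 * r ^+ 2).
Proof.
move=> s.
have cid : {for s, continuous (fun s : R => s)} by apply: cvg_id.
have csq : {for s, continuous (fun s : R => s ^+ 2)} by exact: exprn_continuous.
have cr : {for s, continuous (fun s : R => Num.sqrt (1 - l * s - beta * s ^+ 2))}.
  apply: (@continuous_comp R R R (fun s => 1 - l * s - beta * s ^+ 2) Num.sqrt);
    last exact: sqrt_continuous.
  by apply: cvgB; [apply: cvgB|]; [exact: cvg_cst | apply: cvgM => // ; exact: cvg_cst ..].
have cc (c : R) (h : R -> R) :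
    {for s, continuous h} -> {for s, continuous (fun s => c * h s)}.
  by move=> ch; apply: cvgM => //; exact: cvg_cst.
rewrite /=; apply: cvgD; [apply: cvgD; [apply: cvgD; [apply: cvgD;
  [apply: cvgD|]|]|]|].
- exact: cvg_cst.
- exact: (cc c1 _ cid).
- exact: (cc c2 _ cr).
- exact: (cc c3 _ csq).
- exact: cvgM (cc c4 _ cid) cr.
- apply: (cc c5 (fun s => Num.sqrt (1 - l * s - beta * s ^+ 2) ^+ 2)).
  by apply: (@continuous_comp R R R _ (fun r => r ^+ 2)) => //;
    exact: exprn_continuous.
Qed.

(** * A quadratic function without zeros on a conic *)

Section PlanarSystem.
Variables (R : realType) (l beta c0 c1 c2 c3 c4 c5 : R).

Let f s t : R := c0 + c1 * s + c2 * t + c3 * s ^+ 2 + c4 * s * t + c5 * t ^+ 2.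
Let p s : R := 1 - l * s - beta * s ^+ 2.
Let r s : R := Num.sqrt (p s).

Hypothesis no_zero : forall s t, t ^+ 2 = p s -> f s t <> 0.
Hypothesis f_neg : f 0 (-1) <= 0.
Hypothesis f_pos : 0 <= f 0 1.

Let r0 : r 0 = 1.
Proof. by rewrite /r /p mulr0 expr0n mulr0 !subr0 sqrtr1. Qed.

Let cp : continuous (fun s => f s (r s)).
Proof. exact: continuous_root_conic. Qed.

Let cm : continuous (fun s => f s (- r s)).
Proof.
have := @continuous_root_conic R l beta c0 c1 (- c2) c3 (- c4) c5.
suff -> : (fun s => f s (- r s)) = (fun s : R =>
    let r := Num.sqrt (1 - l * s - beta * s ^+ 2) in
    c0 + c1 * s + - c2 * r + c3 * s ^+ 2 + - c4 * s * r + c5 * r ^+ 2) by [].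
by apply/funext => s; rewrite /f /r /p /=; ring.
Qed.

(** The branches [t = r s] and [t = - r s] meet at [(s, 0)]; whatever the sign of [f] there, one of
    them has opposite weak signs of [f] at its ends. *)
Let no_end s : p s = 0 -> (forall c, 0 <= c <= 1 -> 0 <= p (c * s)) -> False.
Proof.
move=> ps0 pge.
have rs0 : r s = 0 by rewrite /r ps0 sqrtr0.
have [h|h] := lerP (f s 0) 0.
- have [||c c01 fc] := @continuous_zero_between R (fun s => f s (r s)) s.
  + exact: cp.
  + by rewrite r0 rs0 mulr_ge0_le0.
  + by apply: no_zero fc; rewrite sqr_sqrtr // pge.
- have [||c c01 fc] := @continuous_zero_between R (fun s => f s (- r s)) s.
  + exact: cm.
  + by rewrite r0 rs0 oppr0 mulr_le0_ge0 // ltW.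
  + by apply: no_zero fc; rewrite sqrrN sqr_sqrtr // pge.
Qed.

(* At a zero [s] of [p], [p (c s) = (1 - c) (1 + c beta s^2)]; when
   [1 + beta s^2 < 0], the other zero, [-1 / (beta s)], is closer to [0]. *)
Let p_neq0 s : p s <> 0.
Proof.
move=> ps0.
have ls : l * s = 1 - beta * s ^+ 2 by move: ps0; rewrite /p; lra.
have pE c : p (c * s) = (1 - c) * (1 + c * (beta * s ^+ 2)).
  rewrite /p; have -> : l * (c * s) = c * (l * s) by ring.
  by rewrite ls; ring.
have [h|h] := lerP 0 (1 + beta * s ^+ 2).
  apply: (no_end s) => // c /andP[c0' c1']; rewrite pE.
  apply: mulr_ge0; first lra.
  nra.
set w := beta * s ^+ 2 in pE h.
have w0 : w != 0 by apply/eqP => w0; move: h; rewrite w0; lra.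
have hw : - w^-1 * w = -1 by rewrite mulNr mulVf.
have iw : 0 <= - w^-1 <= 1.
  set iw := - w^-1 in hw *; apply/andP; split; nra.
apply: (no_end (- w^-1 * s)).
  by rewrite pE hw; ring.
move=> c /andP[c0' c1']; rewrite mulrA pE -mulrA hw.
move/andP: iw => [i0 i1].
apply: mulr_ge0; last lra.
nra.
Qed.

Let continuous_p : continuous p.
Proof.
move=> s; apply: cvgB; [apply: cvgB|]; first exact: cvg_cst.
- by apply: cvgM; [exact: cvg_cst | exact: cvg_id].
- by apply: cvgM; [exact: cvg_cst | exact: exprn_continuous].
Qed.

Let p_gt0 s : 0 < p s.
Proof.
rewrite ltNge; apply/negP => ps.
have [||c _ pc] := @continuous_zero_between R p s; last exact: p_neq0 pc.
- exact: continuous_p.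
- have -> : p 0 = 1 by rewrite /p; ring.
  by rewrite mul1r.
Qed.

Let fp_gt0 s : 0 < f s (r s).
Proof.
rewrite ltNge; apply/negP => fs.
have [||c _] := @continuous_zero_between R (fun s => f s (r s)) s.
- exact: cp.
- by rewrite r0 mulr_ge0_le0.
- by apply: no_zero; rewrite sqr_sqrtr // ltW.
Qed.

Let fm_lt0 s : f s (- r s) < 0.
Proof.
rewrite ltNge; apply/negP => fs.
have [||c _] := @continuous_zero_between R (fun s => f s (- r s)) s.
- exact: cm.
- by rewrite r0 mulr_le0_ge0.
- by apply: no_zero; rewrite sqrrN sqr_sqrtr // ltW.
Qed.

Lemma planar_beta_le0 : beta <= 0.
Proof.
rewrite leNgt; apply/negP => b0.
have hb : beta * beta^-1 = 1 by rewrite mulfV // gt_eqF.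
have ib : 0 < beta^-1 by rewrite invr_gt0.
(* Adding both inequalities cancels [l], but [beta * (1 + beta^-1) ^+ 2 = beta + 2 + beta^-1 >
   1]. *)
have := p_gt0 (1 + beta^-1); have := p_gt0 (- (1 + beta^-1)).
rewrite /p; set i := beta^-1 in hb ib *; nra.
Qed.

(** [f s (r s) - f s (- r s) = 2 * r s * (c2 + c4 * s)]. *)
Let odd_gt0 s : 0 < c2 + c4 * s.
Proof.
have := fp_gt0 s; have := fm_lt0 s; rewrite /f.
have rs : 0 < r s by rewrite sqrtr_gt0.
by nra.
Qed.

Lemma planar_c4_eq0 : c4 = 0.
Proof.
apply/eqP/negPn/negP => c40.
have := odd_gt0 (- c2 / c4); rewrite mulrCA divff // mulr1; lra.
Qed.

(* The part of [f s (r s)] that is even in [r s] is a quadratic polynomial in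
   [s] with leading coefficient [c3 - beta * c5], and it is dominated by the odd
   part [c2 * r s], which grows linearly. *)
Lemma planar_leading_coef : c3 = beta * c5.
Proof.
have c20 : 0 < c2 by have := odd_gt0 0; rewrite mulr0 addr0.
pose K : R := 1 + `|l| + `|beta|.
have K1 : 1 <= K by rewrite /K -addrA lerDl addr_ge0.
(* Coefficients of the even part once [r s ^+ 2] is replaced by [p s]. *)
pose e0 : R := c0 + c5; pose e1 : R := c1 - c5 * l; pose e2 : R := c3 - beta * c5.
pose M : R := `|e0| + `|e1| + c2 * K.
have rle s : 1 <= s -> r s <= K * s.
  move=> s1.
  rewrite -(@ler_pXn2r _ 2) ?nnegrE ?sqrtr_ge0 //; last nra.
  rewrite sqr_sqrtr ?(ltW (p_gt0 s)) // /p.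
  have := ler_norm (- l); have := ler_norm (- beta); rewrite !normrN => hb hl.
  have h1 : - l * s <= `|l| * s ^+ 2.
    apply: (@le_trans _ _ (`|l| * s)); first by apply: ler_wpM2r => //; lra.
    by apply: ler_wpM2l => //; nra.
  have h2 : - beta * s ^+ 2 <= `|beta| * s ^+ 2.
    by apply: ler_wpM2r => //; exact: sqr_ge0.
  have h3 : 1 - l * s - beta * s ^+ 2 <= K * s ^+ 2.
    by have : 1 <= s ^+ 2 by [nra]; rewrite /K; lra.
  apply: (le_trans h3); rewrite exprMn; apply: ler_wpM2r; first exact: sqr_ge0.
  nra.
have Ele s : 1 <= s -> `|e2| * s <= M.
  move=> s1; have rs := rle s s1.
  have r2 : r s ^+ 2 = p s by rewrite sqr_sqrtr // ltW.
  have hp := fp_gt0 s; have hm := fm_lt0 s.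
  (* Adding [c2 * r s] to the even part gives a positive number, subtracting it a negative one. *)
  have hE : `|e0 + e1 * s + e2 * s ^+ 2| <= c2 * (K * s).
    rewrite ler_norml; move: hp hm; rewrite /f planar_c4_eq0 sqrrN r2 /p /e0 /e1 /e2.
    move=> hp hm; have : c2 * r s <= c2 * (K * s) by rewrite ler_pM2l.
    move=> hh; apply/andP; split; nra.
  have s0 : 0 < s by lra.
  rewrite -(ler_pM2r s0).
  have -> : `|e2| * s * s = `|e2 * s ^+ 2|.
    by rewrite normrM normrX (gtr0_norm s0) -mulrA expr2.
  have -> : e2 * s ^+ 2 = (e0 + e1 * s + e2 * s ^+ 2) - e0 - e1 * s by ring.
  apply: (le_trans (ler_normB _ _)).
  have h1 := ler_normB (e0 + e1 * s + e2 * s ^+ 2) e0.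
  rewrite normrM (gtr0_norm s0) /M.
  have h2 := normr_ge0 e0; nra.
apply/eqP; rewrite -subr_eq0 -/e2 -normr_eq0; apply/negPn/negP => e20.
have e2p : 0 < `|e2| by rewrite lt_def e20 normr_ge0.
have M0 : 0 <= M by rewrite /M !addr_ge0 // mulr_ge0 //; lra.
(* At this point the bound reads [|e2| + M <= M]. *)
have := Ele (1 + M / `|e2|).
rewrite lerDl divr_ge0 // => /(_ isT).
rewrite mulrDr mulr1 mulrCA divff // mulr1; lra.
Qed.

End PlanarSystem.

(** * Bilinear identities and expansions of quadratic functions *)

Section Forms.
Variables (R : realType) (n : nat).
Implicit Types (A B : 'M[R]_n) (u v w : 'cV[R]_n).

Lemma dotvC u v : dotv u v = dotv v u.
Proof. by apply: eq_bigr => i _; rewrite mulrC. Qed.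

Lemma dotvDr u v w : dotv u (v + w) = dotv u v + dotv u w.
Proof. by rewrite -big_split; apply: eq_bigr => i _; rewrite mxE mulrDr. Qed.

Lemma dotvZr (c : R) u v : dotv u (c *: v) = c * dotv u v.
Proof. by rewrite /dotv mulr_sumr; apply: eq_bigr => i _; rewrite mxE mulrCA. Qed.

Lemma dotvDl u v w : dotv (v + w) u = dotv v u + dotv w u.
Proof. by rewrite !(dotvC _ u) dotvDr. Qed.

Lemma dotvZl (c : R) u v : dotv (c *: v) u = c * dotv v u.
Proof. by rewrite !(dotvC _ u) dotvZr. Qed.

Lemma dotv_tr u v : dotv u v = (u^T *m v) ord0 ord0.
Proof. by rewrite mxE; apply: eq_bigr => i _; rewrite mxE. Qed.

Lemma dotv_sym A u v : A^T = A -> dotv (A *m u) v = dotv (A *m v) u.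
Proof. by move=> hA; rewrite [RHS]dotvC !dotv_tr trmx_mul hA mulmxA. Qed.

(** The terms come in the order of [c0], ..., [c5] in the planar system. *)
Lemma quad_expansion A (a m v d : 'cV[R]_n) (s t : R) : A^T = A ->
  quad A a (m + s *: v + t *: d) =
  quad A a m + (2 * dotv (A *m m) v + dotv a v) * s +
  (2 * dotv (A *m m) d + dotv a d) * t +
  dotv (A *m v) v * s ^+ 2 + (2 * dotv (A *m v) d) * s * t +
  dotv (A *m d) d * t ^+ 2.
Proof.
move=> hA; rewrite /quad !mulmxDr -!scalemxAr !(dotvDl, dotvDr, dotvZl, dotvZr).
rewrite (dotv_sym A v m hA) (dotv_sym A d m hA) (dotv_sym A d v hA).
by ring.
Qed.

Lemma quad_form_expansion A v d (t : R) : A^T = A ->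
  dotv (A *m (v + t *: d)) (v + t *: d) =
  dotv (A *m v) v + 2 * t * dotv (A *m d) v + t ^+ 2 * dotv (A *m d) d.
Proof.
move=> hA; rewrite !mulmxDr -!scalemxAr !(dotvDl, dotvDr, dotvZl, dotvZr).
by rewrite (dotv_sym A v d hA); ring.
Qed.

(** Two coordinates suffice: [(1, 0)] if [w] starts with [0], else [(w1, - w0)]. *)
Lemma exists_orthogonal w : (2 <= n)%N -> exists2 v, v != 0 & dotv w v = 0.
Proof.
move=> n2; pose i0 := Ordinal (ltnW n2); pose i1 := Ordinal n2.
have dotd i : dotv w (delta_mx i ord0) = w i ord0.
  rewrite /dotv (bigD1 i) //= big1 ?addr0 => [|j ji]; rewrite mxE !eqxx ?mulr1 //.
  by rewrite (negPf ji) mulr0.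
have [w0|w0] := eqVneq (w i0 ord0) 0.
  exists (delta_mx i0 ord0); last by rewrite dotd.
  by apply/eqP => /matrixP/(_ i0 ord0)/eqP; rewrite !mxE !eqxx oner_eq0.
exists (w i1 ord0 *: delta_mx i0 ord0 + (- w i0 ord0) *: delta_mx i1 ord0).
  apply/eqP => /matrixP/(_ i1 ord0)/eqP; rewrite !mxE !eqxx /= mulr0 add0r mulr1.
  by rewrite oppr_eq0 (negPf w0).
by rewrite dotvDr !dotvZr !dotd; ring.
Qed.

End Forms.

(** * Consequences of a chord without common zero for the two forms *)

Section NoCommonZero.
Variables (R : realType) (n : nat) (A B : 'M[R]_n) (a b : 'cV[R]_n) (c c' : R).
Hypotheses (hA : A^T = A) (hB : B^T = B).
Hypothesis no_zero : forall z, quad B b z = c' -> quad A a z <> c.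
Variables x y : 'cV[R]_n.
Hypotheses (gx : quad B b x = c') (gy : quad B b y = c').
Hypotheses (fx : quad A a x <= c) (fy : c <= quad A a y).

Let m := 2^-1 *: (x + y).
Let d := 2^-1 *: (y - x).

Let mdE v (t : R) : m + t *: d = m + 0 *: v + t *: d.
Proof. by rewrite scale0r addr0. Qed.

Let xE : x = m + (-1) *: d.
Proof.
by apply/matrixP => i j; rewrite !mxE; field.
Qed.

Let yE : y = m + 1 *: d.
Proof.
by apply/matrixP => i j; rewrite !mxE; field.
Qed.

Let g_lin : 2 * dotv (B *m m) d + dotv b d = 0.
Proof.
move: gx gy; rewrite xE yE !(mdE 0) !quad_expansion //; lra.
Qed.

Let g_mid : quad B b m = c' - dotv (B *m d) d.
Proof.
move: gx; rewrite xE !(mdE 0) !quad_expansion // g_lin; lra.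
Qed.

(** Otherwise, by [g_lin] and [g_mid], [quad B b] is [c'] on the whole line, and [quad A a] takes
    the value [c] on the chord. *)
Lemma chord_nonisotropic : dotv (B *m d) d != 0.
Proof.
apply/eqP => k0.
pose phi (s : R) := quad A a (x + s *: (y - x)) - c.
have phiE s : phi s = (quad A a x - c)
    + (2 * dotv (A *m x) (y - x) + dotv a (y - x)) * s
    + dotv (A *m (y - x)) (y - x) * s ^+ 2.
  rewrite /phi; have -> : x + s *: (y - x) = x + s *: (y - x) + 0 *: 0.
    by rewrite scale0r addr0.
  by rewrite quad_expansion //; ring.
have cphi : continuous phi.
  rewrite (funext phiE) => s; apply: cvgD; [apply: cvgD|].
  - exact: cvg_cst.
  - by apply: cvgM; [exact: cvg_cst | exact: cvg_id].
  - by apply: cvgM; [exact: cvg_cst | exact: exprn_continuous].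
have [|s _] := @continuous_zero_between R phi 1 cphi.
  rewrite /phi scale0r addr0 scale1r subrKC.
  by apply: mulr_le0_ge0; rewrite ?subr_le0 ?subr_ge0.
rewrite mulr1 => /eqP; rewrite subr_eq0 => /eqP; apply: no_zero.
have -> : x + s *: (y - x) = m + (2 * s - 1) *: d.
  by apply/matrixP => i j; rewrite !mxE; field.
by rewrite (mdE 0) quad_expansion // g_mid g_lin k0; ring.
Qed.

Lemma no_common_zero_forms v : dotv (B *m d) v = 0 ->
  [/\ dotv (B *m v) v / dotv (B *m d) d <= 0,
      dotv (A *m d) v = 0
    & dotv (A *m v) v = dotv (B *m v) v / dotv (B *m d) d * dotv (A *m d) d].
Proof.
move=> Bdv; have k0 := chord_nonisotropic; set k := dotv (B *m d) d in k0 *.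
(* Dividing [quad B b (m + s *: v + t *: d) = c'] by [k] gives the conic: [Bdv] kills the [s * t]
   term, [g_lin] the [t] term, and [g_mid] makes the constant [1]. *)
pose l := (2 * dotv (B *m m) v + dotv b v) / k.
pose beta := dotv (B *m v) v / k.
pose c0 := quad A a m - c.
pose c1 := 2 * dotv (A *m m) v + dotv a v.
pose c2 := 2 * dotv (A *m m) d + dotv a d.
pose c3 := dotv (A *m v) v.
pose c4 := 2 * dotv (A *m v) d.
pose c5 := dotv (A *m d) d.
have nz s t : t ^+ 2 = 1 - l * s - beta * s ^+ 2 ->
    c0 + c1 * s + c2 * t + c3 * s ^+ 2 + c4 * s * t + c5 * t ^+ 2 <> 0.
  move=> ht hf; apply: (no_zero (m + s *: v + t *: d)).
    rewrite quad_expansion // g_mid g_lin (dotv_sym _ _ _ v d) // Bdv ht /l /beta -/k.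
    by field.
  rewrite quad_expansion //; move: hf; rewrite /c0 /c1 /c2 /c3 /c4 /c5; lra.
have hneg : c0 + c1 * 0 + c2 * -1 + c3 * 0 ^+ 2 + c4 * 0 * -1 + c5 * (-1) ^+ 2 <= 0.
  move: fx; rewrite xE (mdE v) quad_expansion //.
  rewrite /c0 /c1 /c2 /c3 /c4 /c5; lra.
have hpos : 0 <= c0 + c1 * 0 + c2 * 1 + c3 * 0 ^+ 2 + c4 * 0 * 1 + c5 * 1 ^+ 2.
  move: fy; rewrite yE (mdE v) quad_expansion //.
  rewrite /c0 /c1 /c2 /c3 /c4 /c5; lra.
split.
- exact: planar_beta_le0 nz hneg hpos.
- have := planar_c4_eq0 _ _ _ _ _ _ _ _ _ nz hneg hpos.
  by rewrite /c4 (dotv_sym _ _ _ v d) //; lra.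
- exact: planar_leading_coef nz hneg hpos.
Qed.

Lemma no_common_zero_isotropic : (2 <= n)%N ->
  exists u, [/\ u != 0, dotv (A *m u) u = 0 & dotv (B *m u) u = 0].
Proof.
move=> n2; have k0 := chord_nonisotropic.
have [v v0 Bdv] := @exists_orthogonal R n (B *m d) n2.
have [b0 Adv Avv] := no_common_zero_forms v Bdv.
set k := dotv (B *m d) d in k0 b0 Avv; set beta := _ / k in b0 Avv.
have r2 : Num.sqrt (- beta) ^+ 2 = - beta by rewrite sqr_sqrtr // oppr_ge0.
exists (v + Num.sqrt (- beta) *: d); split.
(* Pairing with [B *m d] isolates [Num.sqrt (- beta) * k], so a zero vector would force [v = 0]. *)
- apply/eqP => u0; have : dotv (B *m d) (v + Num.sqrt (- beta) *: d) = 0.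
    by rewrite u0 /dotv big1 // => i _; rewrite [X in _ * X]mxE mulr0.
  rewrite dotvDr Bdv add0r dotvZr => /eqP; rewrite mulf_eq0 (negPf k0) orbF.
  move=> /eqP r0; move: u0; rewrite r0 scale0r addr0 => /eqP.
  by rewrite (negPf v0).
- by rewrite quad_form_expansion // Adv Avv r2; ring.
- rewrite quad_form_expansion // Bdv r2 /beta -/k; by field.
Qed.

(** In [u = v + t *: d] with [dotv (B *m d) v = 0] both cross terms vanish, and the forms have the
    same ratio on [v] and on [d]. *)
Lemma no_common_zero_proportional :
  exists lambda, forall u, dotv (A *m u) u = lambda * dotv (B *m u) u.
Proof.
have k0 := chord_nonisotropic.
exists (dotv (A *m d) d / dotv (B *m d) d) => u.
pose t := dotv (B *m d) u / dotv (B *m d) d.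
pose v := u + (- t) *: d.
have Bdv : dotv (B *m d) v = 0 by rewrite dotvDr dotvZr /t; field.
have uE : u = v + t *: d by rewrite /v scaleNr subrK.
clearbody v t; rewrite {}uE.
have [_ Adv Avv] := no_common_zero_forms v Bdv.
rewrite !quad_form_expansion // Adv Avv Bdv; by field.
Qed.

End NoCommonZero.

(** * Lines and changes of basis in the plane *)

(** A small move [s] along the normal [(p, q)] stays in the set but changes the linear form by
    [s * (p ^+ 2 + q ^+ 2)]. *)
Lemma interior_subset_line (R : realType) (S : set (R^o * R^o)) (p q : R) :
  (p != 0) || (q != 0) -> (forall z, S z -> p * z.1 + q * z.2 = 0) ->
  interior S = set0.
Proof.
move=> pq0 Sline; rewrite -subset0 => -[x y] Sxy.
have cline (z d : R) : (fun s : R => z + s * d) @ (0 : R) --> (z : R^o).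
  rewrite -[X in _ --> X]addr0 -[X in _ + X](mul0r d).
  by apply: cvgD; [exact: cvg_cst | apply: cvgM; [exact: cvg_id | exact: cvg_cst]].
have near_line : nbhs (0 : R) (fun s : R => S (x + s * p, y + s * q)).
  exact: (cvg_pair (cline x p) (cline y q) Sxy).
have /nbhs_ballP[e /= e0 he] := near_line.
have S0 : S (x, y) by exact: interior_subset Sxy.
have : S (x + e / 2 * p, y + e / 2 * q).
  by apply: he; rewrite /ball /= sub0r normrN gtr0_norm ?divr_gt0 //; lra.
move=> /Sline /=; have /= := Sline _ S0 => h0 h1.
have : p ^+ 2 + q ^+ 2 = 0.
  by apply: (@mulfI _ (e / 2)); [rewrite gt_eqF // divr_gt0 | lra].
move=> /eqP; rewrite paddr_eq0 ?sqr_ge0 // !sqrf_eq0 => /andP[p0 q0].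
by move: pq0; rewrite p0 q0.
Qed.

Lemma dotv_pencil (R : realType) (n : nat) (A B : 'M[R]_n) (p q : R) (u v : 'cV[R]_n) :
  dotv ((p *: A + q *: B) *m u) v = p * dotv (A *m u) v + q * dotv (B *m u) v.
Proof. by rewrite mulmxDl -!scalemxAl dotvDl !dotvZl. Qed.

Lemma quad_pencil (R : realType) (n : nat) (A B : 'M[R]_n) (a b : 'cV[R]_n)
    (p q : R) (z : 'cV[R]_n) :
  quad (p *: A + q *: B) (p *: a + q *: b) z = p * quad A a z + q * quad B b z.
Proof. by rewrite /quad dotv_pencil dotvDl !dotvZl; ring. Qed.

(** The matrix with rows [(p, q)] and [(q, - p)] squares to [p ^+ 2 + q ^+ 2] times the identity, so
    applying it again inverts it. *)
Lemma orthogonal_coordinates_inj (R : realType) (p q s t s' t' : R) : 0 < p ^+ 2 + q ^+ 2 ->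
  p * s + q * t = p * s' + q * t' -> q * s + (- p) * t = q * s' + (- p) * t' ->
  s = s' /\ t = t'.
Proof.
move=> D0 e1 e2.
have es : (p ^+ 2 + q ^+ 2) * (s - s') =
    p * (p * s + q * t - (p * s' + q * t')) +
    q * (q * s + (- p) * t - (q * s' + (- p) * t')) by ring.
have et : (p ^+ 2 + q ^+ 2) * (t - t') =
    q * (p * s + q * t - (p * s' + q * t')) -
    p * (q * s + (- p) * t - (q * s' + (- p) * t')) by ring.
move: es et; rewrite e1 e2 !subrr !mulr0 subrr addr0.
move=> /eqP; rewrite mulf_eq0 (gt_eqF D0) subr_eq0 /= => /eqP ->.
by move=> /eqP; rewrite mulf_eq0 (gt_eqF D0) subr_eq0 /= => /eqP ->.
Qed.

Theorem theorem4p11 (R : realType) (n : nat) (hn : (2 <= n)%N)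
    (A B : 'M[R]_n) (a b : 'cV[R]_n)
    (hA : A^T = A) (hB : B^T = B)
    (h : interior (range (joint_map_hom A B)) !=set0 \/ nondegenerate_pair A B) :
  convex_set (range (joint_map A B a b)).
Proof.
move=> P Q k /set_mem[x _ <-] /set_mem[y _ <-]; apply/mem_set.
set W := (X in range _ X).
pose t : R := k%:num.
have t0 : 0 <= t by rewrite /t.
have t1 : t <= 1 by rewrite /t.
have WE : W = (t * quad A a x + (1 - t) * quad A a y,
               t * quad B b x + (1 - t) * quad B b y) by [].
clearbody W t.
pose p := quad A a y - quad A a x; pose q := quad B b y - quad B b x.
(* If [p = q = 0], the segment is a single point. *)
have [D0|D0] := lerP (p ^+ 2 + q ^+ 2) 0.
  have p0 : p = 0 by nra.
  have q0 : q = 0 by nra.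
  exists x => //; rewrite /joint_map WE; congr (_, _).
    by move: p0; rewrite /p; nra.
  by move: q0; rewrite /q; nra.
apply: contrapT => noW.
(* Coordinates along and across the segment: the second is constant on it, the first increases from
   [x] to [y]. *)
pose A' := p *: A + q *: B; pose B' := q *: A + (- p) *: B.
have sA : A'^T = A' by rewrite linearD !linearZ /= hA hB.
have sB : B'^T = B' by rewrite linearD !linearZ /= hA hB.
pose a' := p *: a + q *: b; pose b' := q *: a + (- p) *: b.
pose c := p * W.1 + q * W.2; pose c' := q * W.1 + (- p) * W.2.
have nz z : quad B' b' z = c' -> quad A' a' z <> c.
  rewrite !quad_pencil => e2 e1; apply: noW; exists z => //.
  have [z1 z2] := @orthogonal_coordinates_inj R p q _ _ _ _ D0 e1 e2.
  by rewrite /joint_map z1 z2; case: (W).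
have gx : quad B' b' x = c'.
  by rewrite quad_pencil /c' WE /= /p /q; ring.
have gy : quad B' b' y = c'.
  by rewrite quad_pencil /c' WE /= /p /q; ring.
have fx : quad A' a' x <= c.
  rewrite quad_pencil -subr_ge0.
  have -> : c - (p * quad A a x + q * quad B b x) = (1 - t) * (p ^+ 2 + q ^+ 2).
    by rewrite /c WE /= /p /q; ring.
  by apply: mulr_ge0; lra.
have fy : c <= quad A' a' y.
  rewrite quad_pencil -subr_ge0.
  have -> : p * quad A a y + q * quad B b y - c = t * (p ^+ 2 + q ^+ 2).
    by rewrite /c WE /= /p /q; ring.
  by apply: mulr_ge0; lra.
case: h => [hint | ND].
- have [lambda hl] := @no_common_zero_proportional _ _ _ _ _ _ _ _ sA sB nz _ _ gx gy fx fy.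
  (* Proportionality of [A'] and [B'], rewritten in terms of [A] and [B], puts the homogeneous image
     on a line. *)
  move: hint; rewrite (@interior_subset_line _ _ (p - lambda * q) (q + lambda * p)).
  + by case.
  + rewrite -negb_and; apply/negP => /andP[/eqP p0 /eqP q0]; move: D0.
    have -> : p ^+ 2 + q ^+ 2 = p * (p - lambda * q) + q * (q + lambda * p) by ring.
    by rewrite p0 q0 !mulr0 addr0 ltxx.
  + move=> _ [u _ <-] /=; move: (hl u); rewrite !dotv_pencil; lra.
- have [u [u0 Au Bu]] := @no_common_zero_isotropic _ _ _ _ _ _ _ _ sA sB nz _ _ gx gy fx fy hn.
  move: Au Bu; rewrite !dotv_pencil => Au Bu.
  have [||Au0 Bu0] := @orthogonal_coordinates_inj R p q (dotv (A *m u) u) (dotv (B *m u) u) 0 0 D0.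
  + by rewrite Au; ring.
  + by rewrite Bu; ring.
  + by move: u0; rewrite (ND u Au0 Bu0) eqxx.
Qed.
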